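(* Let $d\ge 2$ and let $C^{END}$ (the extreme negative dependence copula) be the exchangeable FGM copula associated to the random vector $(I_1^-,\dots,I_d^-)$ with probability mass function $$\Pr(I_1^-=i_1,\dots,I_d^-=i_d)=\begin{cases}(r+1-d/2)\binom{d}{r}^{-1}, & i_\bullet=r\\ (d/2-r)\binom{d}{r+1}^{-1}, & i_\bullet=r+1\\ 0,&\text{otherwise},\end{cases}\qquad (i_1,\dots,i_d)\in\{0,1\}^d,$$ where $i_\bullet=\sum_{j=1}^d i_j$ and $r$ is an integer with $r\le d/2\le r+1$. Then the dependence parameters $(\theta_2,\dots,\theta_d)$ of $C^{END}$ are given, for $k\in\{2,\dots,d\}$, by $$\theta_k={}_2F_1\left(-\left\lfloor\tfrac{d+1}{2}\right\rfloor,-k;-2\left\lfloor\tfrac{d+1}{2}\right\rfloor;2\right)=\frac{1+(-1)^k}{2}\cdot\frac{\Gamma(k+1)\,\Gamma\left(\frac12-\left\lfloor\frac{d+1}{2}\right\rfloor\right)}{2^k\,\Gamma\left(\frac k2+1\right)\Gamma\left(\frac{k+1}{2}-\left\lfloor\frac{d+1}{2}\right\rfloor\right)}.$$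
   Context: For an exchangeable random vector $(I_1,\dots,I_d)$ in $\{0,1\}^d$ with $\Pr(I_j=1)=1/2$ for all $j$ and probability mass function $f_{I_1,\dots,I_d}$, the associated exchangeable FGM copula is $$C(u_1,\dots,u_d)=\sum_{(i_1,\dots,i_d)\in\{0,1\}^d} f_{I_1,\dots,I_d}(i_1,\dots,i_d)\prod_{m=1}^d u_m\left(1+(-1)^{i_m}\overline{u}_m\right),\quad \overline{u}_m=1-u_m,\ (u_1,\dots,u_d)\in[0,1]^d.$$ Its dependence parameters $(\theta_2,\dots,\theta_d)$ are the coefficients in the equivalent form $$C(u_1,\dots,u_d)=\left(\prod_{j=1}^d u_j\right)\left(1+\sum_{k=2}^d\sum_{1\le j_1<\dots<j_k\le d}\theta_k\,\overline{u}_{j_1}\cdots\overline{u}_{j_k}\right),$$ equivalently $\theta_k=(-2)^kE\{\prod_{j=1}^k(I_j-\frac12)\}$. ${}_2F_1(a,b;c;z)=\sum_{n\ge0}\frac{(a)_n(b)_n}{(c)_n}\frac{z^n}{n!}$ is the Gauss hypergeometric function, with $(a)_n=a(a+1)\cdots(a+n-1)$. Here $a=-\lfloor (d+1)/2\rfloor$ is a negative integer, and the series is understood as the finite sum terminating when $(a)_n(b)_n$ vanishes, which occurs before $(c)_n$ vanishes. $1/\Gamma$ is taken to be $0$ at the poles of $\Gamma$ (so the right-hand expression is $0$ for odd $k$). $\lfloor y\rfloor$ is the greatest integer not exceeding $y$. *)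

(* Defs.v *)
From HB Require Import structures.
From mathcomp Require Import all_boot all_order all_algebra all_fingroup.
From mathcomp Require Import all_classical all_reals all_analysis.

Set Implicit Arguments.
Unset Strict Implicit.
Unset Printing Implicit Defensive.

Import Order.TTheory GRing.Theory Num.Theory.
Import numFieldNormedType.Exports.

Local Open Scope classical_set_scope.
Local Open Scope ring_scope.

(* A {0,1}-valued random vector of length d enters only through its mass
   function on {ffun 'I_d -> bool}, where true stands for 1 and false for 0
   (in formulas a boolean is coerced to the corresponding natural number). *)
Definition exch_sym_bernoulli_pmf (R : realType) (d : nat)
    (f : {ffun 'I_d -> bool} -> R) : Prop :=
  [/\ forall i, 0 <= f i,
      \sum_i f i = 1,
      forall (s : {perm 'I_d}) (i : {ffun 'I_d -> bool}), f [ffun j => i (s j)] = f i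
    & forall j : 'I_d, \sum_(i : {ffun 'I_d -> bool} | i j) f i = 1 / 2].

Definition FGM_copula (R : realType) (d : nat)
    (f : {ffun 'I_d -> bool} -> R) (u : 'I_d -> R) : R :=
  \sum_(i : {ffun 'I_d -> bool})
    f i * \prod_(m < d) (u m * (1 + (-1) ^+ (i m) * (1 - u m))).

(* Increasing indices j_1 < ... < j_k are encoded as a k-element set A.
   Only theta 2, ..., theta d are meaningful. *)
Definition dependence_parameters (R : realType) (d : nat)
    (C : ('I_d -> R) -> R) (theta : nat -> R) : Prop :=
  forall u : 'I_d -> R, (forall j, 0 <= u j <= 1) ->
    C u = (\prod_(j < d) u j) *
          (1 + \sum_(2 <= k < d.+1) \sum_(A : {set 'I_d} | #|A| == k)
                 theta k * \prod_(j in A) (1 - u j)).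

(* absz : int -> nat is the absolute value; the constraint
   r <= d/2 <= r + 1 with d >= 2 forces r >= 0, so absz r is r itself. *)
Definition END_pmf (R : realType) (d : nat) (r : int)
    (i : {ffun 'I_d -> bool}) : R :=
  let i_sum : nat := (\sum_(j < d) i j)%N in
  if i_sum%:Z == r then
    (r%:~R + 1 - d%:R / 2) * ('C(d, absz r)%:R)^-1
  else if i_sum%:Z == r + 1 then
    (d%:R / 2 - r%:~R) * ('C(d, absz (r + 1))%:R)^-1
  else 0.

Definition pochhammer (R : realType) (a : R) (n : nat) : R :=
  \prod_(j < n) (a + j%:R).

(* Since x / 0 = 0, a term with a vanishing denominator (c)_n is 0.  Hence when
   (a)_n (b)_n vanishes before (c)_n does, this is the terminating finite sum,
   for every z. *)
Definition hyp2F1 (R : realType) (a b c z : R) : R :=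
  limn (series (fun n : nat =>
    pochhammer a n * pochhammer b n / pochhammer c n * (z ^+ n / n`!%:R))).

Definition Gamma_integral (R : realType) (x : R) : R :=
  \int[lebesgue_measure]_(t in `]0%R, +oo[) (t `^ (x - 1) * expR (- t)).

(* The least n such that 0 < x + n. *)
Definition Gamma_shift (R : realType) (x : R) : nat :=
  if 0 < x then 0%N else (Num.truncn (- x)).+1.

(* Euler's integral for x > 0, continued to x <= 0 by
   Gamma (x + n) = x (x + 1) ... (x + n - 1) Gamma x.  Junk value 0 at the
   poles 0, -1, -2, ... *)
Definition Gamma (R : realType) (x : R) : R :=
  let n := Gamma_shift x in Gamma_integral (x + n%:R) / pochhammer x n.

Definition rGamma (R : realType) (x : R) : R :=
  if (x \is a Num.int) && (x <= 0) then 0 else (Gamma x)^-1.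

(* Main.v *)
(* The END vector is the beginning of a uniformly chosen vector of {0,1}^(2m)
   with exactly m ones, m = floor((d+1)/2), so that
   E[I_1 ... I_n] = C(2m-n, m) / C(2m, m).  Expanding the product of the
   1 - 2 I_j gives the terminating 2F1 series for theta_k.  Writing
   1 - X = (1 + X) - 2 X, the same sum is, up to C(2m, m), the coefficient c_k
   of X^m in (1 - X)^k (1 + X)^(2m-k).  Looking at the coefficient of X^m in
   2m q - 2 X q' for q = (1 - X)^(k+1) (1 + X)^(2m-k-1) yields
   (k+1) c_k + (2m-k-1) c_(k+2) = 0, with c_1 = 0; hence the odd c_k vanish and
   the even ones are quotients of Pochhammer symbols.  For the Gamma form it is
   enough to know Gamma (n+1) = n! and 0 < Gamma (1/2) < oo, as all the other
   arguments are of the form 1/2 - p with p a natural number. *)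

Require Import Defs.
From HB Require Import structures.
From mathcomp Require Import all_boot all_order all_algebra all_fingroup.
From mathcomp Require Import all_classical all_reals all_analysis.
From mathcomp Require Import measurable_realfun.
From mathcomp Require Import ring lra zify.

Import Order.TTheory GRing.Theory Num.Theory.
Import numFieldNormedType.Exports.

Local Open Scope ring_scope.

(** * Krawtchouk numbers: generating polynomial and two-step recurrence *)

Lemma coef_1DXn (R : comNzRingType) (n i : nat) :
  ((1 + 'X) ^+ n : {poly R})`_i = 'C(n, i)%:R.
Proof.
rewrite exprDn; under eq_bigr do rewrite expr1n mul1r -scaler_nat.
rewrite -(poly_def n.+1 (fun i => 'C(n, i)%:R)) coef_poly.
by case: ltnP => // ltni; rewrite bin_small.
Qed.

(** For [k <= 2 * m] this is the binary Krawtchouk polynomial of degree [m] and length [2 * m],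
    evaluated at [k]. *)
Definition krawtchouk (R : realFieldType) (m k : nat) : R :=
  \sum_(n < k.+1) 'C(k, n)%:R * (- 2) ^+ n * 'C(2 * m - n, m)%:R.

Lemma krawtchouk_coef (R : realFieldType) (m k : nat) : (k <= 2 * m)%N ->
  krawtchouk R m k = ((1 - 'X) ^+ k * (1 + 'X) ^+ (2 * m - k) : {poly R})`_m.
Proof.
move=> km.
have -> : (1 - 'X : {poly R}) = (1 + 'X) + (- 2%:P) * 'X by ring.
rewrite exprDn mulr_suml coef_sum; apply: eq_bigr => /= n _.
have kn : (n <= k)%N by rewrite -ltnS.
rewrite [(_ * _ *+ _) * _]mulrnAl coefMn -[RHS]mulr_natl -mulrA; congr (_ * _).
rewrite mulrAC -exprD.
have -> : (k - n + (2 * m - k) = 2 * m - n)%N by lia.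
rewrite exprMn mulrCA -rmorphN -rmorphXn/= coefCM coefMXn coef_1DXn.
(* For [m < n] both sides vanish; otherwise symmetry of the binomials trades [m - n] for [m]. *)
congr (_ * _); case: ltnP => mn; first by rewrite bin_small//; lia.
by rewrite -bin_sub; [congr ('C(_, _)%:R); lia|lia].
Qed.

(* On the homogenization of degree [2 * m] of [q] this is the operator
   [y * d/dy - x * d/dx], which kills the middle monomial. *)
Lemma coef_middle_euler (R : comNzRingType) (m : nat) (q : {poly R}) :
  ((2 * m)%:R *: q - 2 *: ('X * q^`()))`_m = 0.
Proof.
rewrite coefB !coefZ coefXM coef_deriv; case: m => [|m] /=.
  by rewrite muln0 mul0r mulr0 subrr.
by rewrite natrM -mulr_natl; ring.
Qed.

(** The case k = -1 of the recurrence: for q = (1 + X)^(2m), the polynomial 2m q - 2 X q' equals 2m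
    (1 - X) (1 + X)^(2m-1). *)
Lemma krawtchouk1 (R : realFieldType) (m : nat) : (0 < m)%N ->
  krawtchouk R m 1 = 0.
Proof.
move=> m0; rewrite krawtchouk_coef; last by lia.
have := coef_middle_euler _ m ((1 + 'X) ^+ (2 * m) : {poly R}).
rewrite deriv_exp derivD derivX derivC add0r mul1r.
have -> : (2 * m)%:R *: (1 + 'X : {poly R}) ^+ (2 * m)
  - 2 *: ('X * ((1 + 'X) ^+ (2 * m).-1 *+ (2 * m)))
  = (2 * m)%:R *: ((1 - 'X) ^+ 1 * (1 + 'X) ^+ (2 * m - 1)).
  have [p ->] : exists p, (2 * m = p.+1)%N by exists (2 * m).-1; lia.
  by rewrite subn1 /= exprS !scaler_nat; ring.
rewrite coefZ => /eqP; rewrite mulf_eq0 pnatr_eq0; case/orP => /eqP//; lia.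
Qed.

Lemma krawtchoukSS (R : realFieldType) (m k : nat) : (k.+2 <= 2 * m)%N ->
  k.+1%:R * krawtchouk R m k + (2 * m - k.+1)%:R * krawtchouk R m k.+2 = 0.
Proof.
move=> km; rewrite !krawtchouk_coef; [|lia..].
rewrite -!coefZ -coefD.
apply: etrans (coef_middle_euler _ m
  ((1 - 'X) ^+ k.+1 * (1 + 'X) ^+ (2 * m - k.+1))).
apply: (congr1 (fun q : {poly R} => q`_m)).
rewrite derivM !deriv_exp derivB derivD derivX derivC/= !add0r.
(* With 2m = k + 2 + p, the factor (1 - X)^k (1 + X)^p is common to all terms, and the cofactor on
   the recurrence side is (k+1) (1 + X)^2 + (p+1) (1 - X)^2. *)
rewrite -(subnKC km); set p := (2 * m - k.+2)%N.
have -> : (k.+2 + p - k = p.+2)%N by lia.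
have -> : (k.+2 + p - k.+1 = p.+1)%N by lia.
have -> : (k.+2 + p - k.+2 = p)%N by lia.
by rewrite /= !exprS !scaler_nat; ring.
Qed.

Lemma krawtchouk_odd (R : realFieldType) (m k : nat) :
  odd k -> (k <= 2 * m)%N -> krawtchouk R m k = 0.
Proof.
move=> oddk; rewrite -(odd_double_half k) oddk add1n.
elim: (k./2) => [|l IH] lm.
  by apply: krawtchouk1; lia.
have := krawtchoukSS R m l.*2.+1; rewrite IH; last by lia.
rewrite mulr0 add0r doubleS => /(_ lm)/eqP; rewrite mulf_eq0 pnatr_eq0.
case/orP => /eqP//; lia.
Qed.

Lemma pochhammer0 (R : realType) (a : R) : pochhammer a 0 = 1.
Proof. exact: big_ord0. Qed.

Lemma pochhammerS (R : realType) (a : R) (n : nat) :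
  pochhammer a n.+1 = pochhammer a n * (a + n%:R).
Proof. exact: big_ord_recr. Qed.

(** Halved, the recurrence reads (l + 1/2) c_(2l) = (1/2 - m + l) c_(2l+2), so each step contributes
    one new factor to each Pochhammer symbol. *)
Lemma krawtchouk_even (R : realType) (m l : nat) : (l <= m)%N ->
  krawtchouk R m l.*2 * pochhammer (1 / 2 - m%:R) l =
  'C(2 * m, m)%:R * pochhammer (1 / 2 : R) l.
Proof.
elim: l => [|l IH] lm.
  by rewrite /krawtchouk big_ord1 !pochhammer0 bin0 subn0 !mulr1 mul1r.
have := krawtchoukSS R m l.*2; rewrite -doubleS => /(_ ltac:(lia)).
rewrite natrB; last by lia.
rewrite -natr1 natrM (_ : l.*2%:R = l%:R * 2); last by rewrite -natrM muln2.
move=> E; rewrite !pochhammerS [RHS]mulrA -IH; last by lia.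
have -> : krawtchouk R m l.+1.*2 *
   (pochhammer (1 / 2 - m%:R) l * (1 / 2 - m%:R + l%:R))
 = - pochhammer (1 / 2 - m%:R) l * (1/2) * ((2 * m%:R - (l%:R * 2 + 1)) *
     krawtchouk R m l.+1.*2) by field.
by have -> : (2 * m%:R - (l%:R * 2 + 1)) * krawtchouk R m l.+1.*2 = 
   - ((l%:R * 2 + 1) * krawtchouk R m l.*2); [lra | field].
Qed.

(** * Counting and summing over subsets *)

(** Complementation turns the supersets of [D] of size [s] into the subsets of [~: D] of size
    [#|T| - s]. *)
Lemma card_supersets (T : finType) (D : {set T}) (s : nat) : (s <= #|T|)%N ->
  #|[set B : {set T} | (D \subset B) && (#|B| == s)]| =
  'C(#|T| - #|D|, #|T| - s).
Proof.
move=> sT; have -> : (#|T| - #|D| = #|~: D|)%N.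
  by rewrite [RHS]cardsCs finset.setCK.
rewrite -cards_draws -(card_imset _ (can_inj (@finset.setCK T))).
apply: eq_card => B; rewrite !inE; apply/imsetP/idP => [[A]|].
  rewrite inE => /andP[DA /eqP <-] ->; rewrite finset.setCS DA /=.
  by rewrite (cardsCs A) subKn ?max_card.
move=> /andP[BD /eqP cB]; exists (~: B)%SET; last by rewrite finset.setCK.
by rewrite inE -finset.setCS finset.setCK BD cardsCs finset.setCK cB subKn ?eqxx.
Qed.

Lemma sum_subset_card (R : nzRingType) (T : finType) (A : {set T})
    (phi : nat -> R) :
  \sum_(D : {set T} | D \subset A) phi #|D| =
  \sum_(n < #|A|.+1) 'C(#|A|, n)%:R * phi n.
Proof.
rewrite (partition_big (fun D : {set T} => inord #|D| : 'I_#|A|.+1) predT)//=.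
apply: eq_bigr => n _; rewrite -cards_draws -sum1dep_card natr_sum mulr_suml.
apply: eq_big => [D|D /andP[DA /eqP nE]].
  case DA : (D \subset A) => //=.
  by rewrite -val_eqE /= inordK // ltnS subset_leq_card.
by rewrite mul1r -nE inordK // ltnS subset_leq_card.
Qed.

Lemma sum_set_card (V : nmodType) (T : finType) (F : {set T} -> V) :
  \sum_(A : {set T}) F A =
  \sum_(0 <= k < #|T|.+1) \sum_(A : {set T} | #|A| == k) F A.
Proof.
rewrite big_mkord.
rewrite (partition_big (fun A : {set T} => inord #|A| : 'I_#|T|.+1) predT)//=.
apply: eq_bigr => k _; apply: eq_bigl => A.
by rewrite -val_eqE /= inordK // ltnS max_card.
Qed.

Lemma sum_ffun_set (V : nmodType) (T : finType) (F : {set T} -> V) :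
  \sum_(i : {ffun T -> bool}) F [set j | i j]%SET = \sum_(B : {set T}) F B.
Proof.
rewrite (reindex (fun B : {set T} => [ffun j => j \in B])) /=.
  by apply: eq_bigr => B _; congr F; apply/setP => j; rewrite inE ffunE.
exists (fun i : {ffun T -> bool} => [set j | i j]%SET) => [B _|i _].
  by apply/setP => j; rewrite inE ffunE.
by apply/ffunP => j; rewrite ffunE inE.
Qed.

(** Each sign is 1 - 2 [j in B]. Padding the product with factors 1 outside [A] lets it be expanded
    over all [D]; the terms with [D] not inside [A] vanish. *)
Lemma prod_sign_subset (R : comNzRingType) (T : finType) (A B : {set T}) :
  \prod_(j in A) (-1) ^+ (j \in B) =
  \sum_(D : {set T} | D \subset A) (- 2) ^+ #|D| * (D \subset B)%:R :> R.
Proof.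
have -> : \prod_(j in A) (-1) ^+ (j \in B) =
          \prod_j ((- 2) * ((j \in A) && (j \in B))%:R + 1) :> R.
  rewrite big_mkcond /=; apply: eq_bigr => j _.
  by case: (j \in A); case: (j \in B) => /=; ring.
rewrite bigA_distr [RHS]big_mkcond /=; apply: eq_bigr => D _.
rewrite -big_mkcond/= big_split /= prodr_const.
have [DA|/fintype.subsetPn[j jD jA]] := boolP (D \subset A); last first.
  by rewrite (bigD1 j)//= (negbTE jA) mul0r mulr0.
congr (_ * _); have [DB|/fintype.subsetPn[j jD jB]] :=
  boolP (D \subset B); last first.
  by rewrite (bigD1 j)//= (negbTE jB) andbF mul0r.
by rewrite big1// => j jD; rewrite (fintype.subsetP DA)// (fintype.subsetP DB).
Qed.

(** * Inclusion probabilities and sign moments of the middle layer *)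

Section middle_layer.
Variables (R : realType) (d : nat).
Let m := ((d + 1) %/ 2)%N.

(* The law of the first [d] coordinates of a uniformly chosen vector of
   {0,1}^(2m) having exactly [m] ones. *)
Definition middle_layer (B : {set 'I_d}) : R :=
  ((#|B| == m) || (#|B| == (d - m)%N))%:R / 'C(2 * m, m)%:R.

(** This is the probability that all coordinates in [D] are 1. If d = 2m - 1, the sizes m and m - 1
    correspond to the two values of the dropped coordinate, and Pascal's rule adds their counts; if
    d = 2m, the two sizes coincide. *)
Lemma sum_middle_layer (D : {set 'I_d}) :
  \sum_(B : {set 'I_d} | D \subset B) middle_layer B =
  'C(2 * m - #|D|, m)%:R / 'C(2 * m, m)%:R.
Proof.
rewrite -mulr_suml; congr (_ / _).
under eq_bigr do rewrite mulrb.
rewrite -big_mkcondr /= sumr_const -mulr_natl mulr1; congr (_%:R).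
have Dd : (#|D| <= d)%N by rewrite -[leqRHS]card_ord max_card.
pose S s := [set B : {set 'I_d} | (D \subset B) && (#|B| == s)]%SET.
have cS s : (s <= d)%N -> #|S s| = 'C(d - #|D|, d - s).
  by move=> sd; rewrite card_supersets card_ord.
transitivity #|S m :|: S (d - m)%N|.
  by apply: eq_card => B; rewrite !inE -andb_orr.
case: (boolP (odd d)) => od.
  have dm : d = (2 * m).-1 by rewrite /m; lia.
  rewrite cardsU finset.disjoint_setI0 ?cards0 ?subn0; last first.
    rewrite -setI_eq0; apply/eqP/setP => B; rewrite !inE.
    by apply/negP => /andP[/andP[_ /eqP ->] /andP[_]]; lia.
  rewrite !cS; [|lia..].
  have -> : (2 * m - #|D| = (d - #|D|).+1)%N by lia.
  have -> : (d - (d - m) = m)%N by lia.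
  have -> : (d - m = m.-1)%N by lia.
  have [p ->] : exists p, m = p.+1 by exists m.-1; lia.
  by rewrite binS addnC.
have dm : d = (2 * m)%N by rewrite /m; lia.
have -> : (d - m = m)%N by lia.
rewrite finset.setUid cS; last by lia.
by rewrite -dm (_ : d - m = m)%N//; lia.
Qed.

(** After expanding the signs and exchanging the sums, the inclusion probability of [D] depends only
    on its size, so the subsets of [A] can be grouped by cardinality. *)
Lemma middle_layer_sign (A : {set 'I_d}) :
  \sum_(B : {set 'I_d}) middle_layer B * \prod_(j in A) (-1) ^+ (j \in B) =
  krawtchouk R m #|A| / 'C(2 * m, m)%:R.
Proof.
under eq_bigr do rewrite prod_sign_subset mulr_sumr.
rewrite exchange_big /=.
under eq_bigr => D _.
  under eq_bigr do rewrite mulrCA mulr_natr mulrb.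
  rewrite -mulr_sumr -big_mkcond/= sum_middle_layer; over.
rewrite (sum_subset_card _ _ _ (fun n => (- 2) ^+ n *
  ('C(2 * m - n, m)%:R / 'C(2 * m, m)%:R))).
by rewrite mulr_suml; apply: eq_bigr => n _; rewrite !mulrA.
Qed.

End middle_layer.

(** * The END mass function as a middle layer law *)

(** If d = 2p + 1, then r = p is forced, both weights are 1/2, and C(2m, m) = 2 C(d, p). If d = 2m,
    then r is m or m - 1; the layer of size m gets weight 1 and the other one weight 0. *)
Lemma END_pmfE (R : realType) (d : nat) (r : int) (i : {ffun 'I_d -> bool}) :
  (2 <= d)%N -> r%:~R <= (d%:R / 2 : R) <= r%:~R + 1 ->
  END_pmf R r i = middle_layer R d [set j | i j]%SET.
Proof.
move=> hd /andP[hr1 hr2]; rewrite /END_pmf /middle_layer.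
have -> : (\sum_(j < d) i j)%N = #|[set j | i j]%SET|.
  rewrite -sum1dep_card [RHS]big_mkcond /=.
  by apply: eq_bigr => j _; case: (i j).
set s := #|_|; set m := ((d + 1) %/ 2)%N.
have r2d : 2 * r <= d%:Z.
  by rewrite -(ler_int R) rmorphM/=; lra.
have dr2 : d%:Z <= 2 * r + 2.
  by rewrite -(ler_int R) rmorphD rmorphM/=; lra.
have C0 : ('C(2 * m, m)%:R : R) != 0 by rewrite pnatr_eq0 -lt0n bin_gt0; lia.
case: (boolP (odd d)) => od.
  have [p dp] : exists p, d = (2 * p).+1 by exists d./2; lia.
  have rp : r = p%:Z by lia.
  have mp : m = p.+1 by rewrite /m; lia.
  have CC : 'C(2 * m, m)%:R = 2 * 'C(d, p)%:R :> R.
    rewrite mp dp -natrM; congr (_%:R).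
    have -> : (2 * p.+1 = (2 * p).+2)%N by lia.
    rewrite binS [RHS]mul2n -addnn; congr (_ + _)%N.
    by rewrite -[RHS]bin_sub; [congr 'C(_, _); lia|lia].
  have CC' : 'C(d, p.+1) = 'C(d, p).
    by rewrite dp -bin_sub; [congr 'C(_, _); lia|lia].
  rewrite rp (_ : p%:Z + 1 = p.+1%:Z); last by lia.
  rewrite !absz_nat CC' CC !eqz_nat mp (_ : d - p.+1 = p)%N; last by lia.
  have dR : d%:R = 2 * p%:R + 1 :> R by rewrite dp -natr1 natrM.
  move: C0; rewrite CC mulf_eq0 negb_or => /andP[_ C0].
  rewrite dR (_ : p%:~R = p%:R)//.
  case: (s =P p) => [->|_]; first by rewrite orbT /=; field.
  by case: (s =P p.+1) => [_|_] /=; [field|rewrite mul0r].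
have dm : d = (2 * m)%N by rewrite /m; lia.
have dR : d%:R = 2 * m%:R :> R by rewrite {1}dm natrM.
rewrite (_ : d - m = m)%N ?orbb; last by lia.
have [rm|rm] : r = m%:Z \/ r + 1 = m%:Z by lia.
  rewrite rm absz_nat eqz_nat dR {1}dm (_ : m%:~R = m%:R)//.
  case: (s =P m) => [_|_] /=; first by field.
  rewrite mul0r; case: ifP => // _.
  by rewrite [X in X / _](_ : _ = 0) ?mul0r//; field.
have rE : r%:~R = m%:R - 1 :> R.
  by rewrite (_ : m%:R = m%:Z%:~R)// -rm rmorphD/= addrK.
rewrite rm rE absz_nat eqz_nat dR {2}dm.
rewrite [_ + 1 - _](_ : _ = 0) ?mul0r; last by field.
case: (s =P m) => [sm|_] /=.
  by rewrite ifF; [field|apply/eqP; lia].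
by rewrite mul0r; case: ifP.
Qed.

Lemma END_pmf_exch (R : realType) (d : nat) (r : int) :
  (2 <= d)%N -> r%:~R <= (d%:R / 2 : R) <= r%:~R + 1 ->
  exch_sym_bernoulli_pmf (@END_pmf R d r).
Proof.
move=> hd hr; set m := ((d + 1) %/ 2)%N.
have m0 : (0 < m)%N by rewrite /m; lia.
have C0 : ('C(2 * m, m)%:R : R) != 0 by rewrite pnatr_eq0 -lt0n bin_gt0; lia.
split.
- by move=> i; rewrite END_pmfE// divr_ge0.
- under eq_bigr do rewrite END_pmfE//.
  rewrite (sum_ffun_set _ _ (middle_layer R d)).
  rewrite (eq_bigl (fun B : {set 'I_d} => finset.set0 \subset B)); last first.
    by move=> B; rewrite finset.sub0set.
  by rewrite sum_middle_layer cards0 subn0 divff.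
- move=> s i; rewrite !END_pmfE// /middle_layer.
  suff -> : #|[set j | [ffun j0 => i (s j0)] j]%SET| = #|[set j | i j]%SET| by [].
  rewrite -[RHS](card_preimset _ (@perm_inj _ s)).
  by apply: eq_card => j; rewrite !inE ffunE.
- move=> j; under eq_bigr do rewrite END_pmfE//.
  transitivity (\sum_(B : {set 'I_d} | [set j]%SET \subset B)
      middle_layer R d B).
    rewrite big_mkcond [RHS]big_mkcond -sum_ffun_set /=.
    by apply: eq_bigr => i _; rewrite finset.sub1set inE.
  rewrite sum_middle_layer cards1 -/m.
  apply: (mulIf C0); rewrite mulfVK// mul1r.
  (* The marginal is C(2m-1, m) / C(2m, m), and 2m C(2m-1, m) = m C(2m, m). *)
  have := mul_bin_down (2 * m) m; rewrite -subn1.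
  have -> : (2 * m - m = m)%N by lia.
  rewrite -mulnA mulnCA => /eqP; rewrite eqn_pmul2l// => /eqP <-.
  by rewrite natrM mulKf// pnatr_eq0.
Qed.

(** * Existence and uniqueness of the dependence parameters *)

(** Once the u_j are factored out, expanding the product of the 1 + (-1)^(i_j) (1 - u_j) over index
    sets [A] leaves the expected product of signs over [A] as coefficient. *)
Lemma END_dependence_parameters (R : realType) (d : nat) (r : int) :
  (2 <= d)%N -> r%:~R <= (d%:R / 2 : R) <= r%:~R + 1 ->
  let m := ((d + 1) %/ 2)%N in
  dependence_parameters (FGM_copula (@END_pmf R d r))
    (fun k => krawtchouk R m k / 'C(2 * m, m)%:R).
Proof.
move=> hd hr m u _; rewrite /FGM_copula.
have m0 : (0 < m)%N by rewrite /m; lia.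
have C0 : ('C(2 * m, m)%:R : R) != 0 by rewrite pnatr_eq0 -lt0n bin_gt0; lia.
transitivity ((\prod_(j < d) u j) * \sum_(A : {set 'I_d})
    krawtchouk R m #|A| / 'C(2 * m, m)%:R * \prod_(j in A) (1 - u j)).
  under eq_bigr do rewrite big_split /= mulrCA.
  rewrite -mulr_sumr; congr (_ * _).
  transitivity (\sum_(B : {set 'I_d}) middle_layer R d B *
      \prod_(j < d) ((-1) ^+ (j \in B) * (1 - u j) + 1)).
    rewrite -sum_ffun_set; apply: eq_bigr => i _; rewrite END_pmfE//.
    by congr (_ * _); apply: eq_bigr => j _; rewrite inE addrC.
  under eq_bigr => B _ do rewrite bigA_distr mulr_sumr.
  rewrite exchange_big; apply: eq_bigr => A _ /=.
  rewrite -middle_layer_sign mulr_suml; apply: eq_bigr => B _.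
  by rewrite -big_mkcond big_split /= mulrA.
congr (_ * _); rewrite sum_set_card card_ord.
(* The size 0 term is the leading 1, and the size 1 terms vanish by [krawtchouk1]. *)
rewrite big_ltn// big_ltn//; last by lia.
rewrite (big_pred1 finset.set0); last by move=> A; rewrite cards_eq0.
rewrite finset.big_set0 cards0 mulr1.
rewrite {1}/krawtchouk big_ord1 bin0 subn0 !mul1r divff//.
rewrite [X in _ + (X + _)]big1 ?add0r; last first.
  by move=> A /eqP ->; rewrite krawtchouk1// !mul0r.
by congr (_ + _); apply: eq_bigr => k _; apply: eq_bigr => A /eqP ->.
Qed.

(** The system is triangular: at a suitable point for each [k], all terms of order above [k] vanish,
    and those below [k] agree by induction. *)
Lemma dependence_parameters_unique (R : realType) (d : nat)
    (C : ('I_d -> R) -> R) (theta theta' : nat -> R) :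
  dependence_parameters C theta -> dependence_parameters C theta' ->
  forall k, (2 <= k <= d)%N -> theta k = theta' k.
Proof.
move=> ht ht'; elim/ltn_ind => k IH /andP[k2 kd].
(* A set with more than [k] elements contains an index [j >= k], where 1 - u_j = 0; the set of the
   first [k] indices contributes a positive amount to [c k]. No u_j is 0, so their product
   cancels. *)
pose u (j : 'I_d) : R := if (j < k)%N then 1 / 2 else 1.
have u01 j : 0 <= u j <= 1 by rewrite /u; case: ifP => _; lra.
have u0 : \prod_(j < d) u j != 0.
  by apply/prodf_neq0 => j _; rewrite /u; case: ifP => _; rewrite gt_eqF//; lra.
have := ht u u01; rewrite (ht' u u01) => /(mulfI u0)/addrI.
pose c n : R := \sum_(A : {set 'I_d} | #|A| == n) \prod_(j in A) (1 - u j).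
under eq_bigr do rewrite -mulr_sumr -/(c _).
under [RHS]eq_bigr do rewrite -mulr_sumr -/(c _).
have ck0 n : (k < n)%N -> c n = 0.
  move=> kn; rewrite /c big1// => A /eqP An.
  have [j jA kj] : exists2 j, j \in A & (k <= j)%N.
    apply/fintype.exists_inP; apply: contraT => /fintype.exists_inPn Ak.
    have : A \subset [set j : 'I_d | (j < k)%N]%SET.
      apply/fintype.subsetP => j jA; rewrite inE ltnNge.
      exact: Ak.
    move=> /subset_leq_card; rewrite An; apply: contraTT => _.
    rewrite -ltnNge (leq_ltn_trans _ kn)// -sum1dep_card.
    by rewrite big_ord_narrow// sum1_card card_ord.
  by rewrite (bigD1 j)//= /u ltnNge kj subrr mul0r.
have ck : c k != 0.
  rewrite gt_eqF// /c.
  rewrite (bigD1 [set j : 'I_d | (j < k)%N]%SET)/=; last first.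
    by rewrite -sum1dep_card big_ord_narrow// sum1_card card_ord.
  rewrite ltr_wpDr//.
    by apply: sumr_ge0 => A _; apply: prodr_ge0 => j _; have := u01 j; lra.
  by apply: prodr_gt0 => j; rewrite inE /u => ->; lra.
rewrite (big_cat_nat (n := k))//; last by lia.
rewrite [RHS](big_cat_nat (n := k))//; last by lia.
rewrite /= !(@big_ltn _ _ _ k)//.
have z (th : nat -> R) : \sum_(k.+1 <= i < d.+1) th i * c i = 0.
  by rewrite big_nat_cond big1// => i /andP[/andP[ki _] _]; rewrite ck0 ?mulr0.
rewrite !z !addr0.
rewrite (@eq_big_nat _ _ _ _ _ _ (fun i => theta i * c i)).
  by move=> /addrI/(mulIf ck)/esym.
by move=> i /andP[i2 ik]; rewrite IH//; lia.
Qed.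

(** * The terminating hypergeometric series *)

Lemma pochhammer_oppr_gt (R : realType) (p n : nat) : (p < n)%N ->
  pochhammer (- p%:R : R) n = 0.
Proof.
by move=> pn; rewrite /pochhammer (bigD1 (Ordinal pn))//= addNr mul0r.
Qed.

Lemma pochhammer_oppr_neq0 (R : realType) (p n : nat) : (n <= p)%N ->
  pochhammer (- p%:R : R) n != 0.
Proof.
move=> np; apply/prodf_neq0 => j _.
by rewrite addrC subr_eq0 eqr_nat ltn_eqF// (leq_trans (ltn_ord j)).
Qed.

Lemma pochhammer_oppr_bin (R : realType) (k n : nat) :
  pochhammer (- k%:R : R) n = (-1) ^+ n * n`!%:R * 'C(k, n)%:R.
Proof.
elim: n => [|n IH]; first by rewrite pochhammer0 bin0 !mulr1.
rewrite pochhammerS IH factS natrM.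
have : n.+1%:R * 'C(k, n.+1)%:R = (k%:R - n%:R) * 'C(k, n)%:R :> R.
  have [nk|kn] := leqP n k; first by rewrite -natrB// -!natrM mul_bin_left.
  by rewrite !bin_small ?mulr0//; lia.
move=> E; rewrite exprS.
transitivity (- (-1) ^+ n * n`!%:R * ((k%:R - n%:R) * 'C(k, n)%:R) : R).
  by ring.
by rewrite -E; ring.
Qed.

(** The ratio (-m)_n / (-2m)_n, cross-multiplied so that it remains valid when (-2m)_n = 0. *)
Lemma bin_ratio (R : realType) (m n : nat) :
  'C(2 * m - n, m)%:R * pochhammer (- (2 * m%:R) : R) n =
  'C(2 * m, m)%:R * pochhammer (- m%:R : R) n.
Proof.
elim: n => [|n IH]; first by rewrite subn0 !pochhammer0.
(* Beyond [m] the right side vanishes, and on the left either the Pochhammer symbol or the binomial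
   does. *)
have [mn|nm] := ltnP m n.+1.
  rewrite pochhammer_oppr_gt// mulr0.
  have [m2|m2] := ltnP (2 * m) n.+1.
    by rewrite -natrM pochhammer_oppr_gt// mulr0.
  by rewrite bin_small ?mul0r//; lia.
rewrite !pochhammerS [RHS]mulrA -IH.
have : (2 * m - n)%:R * 'C(2 * m - n.+1, m)%:R =
    (m - n)%:R * 'C(2 * m - n, m)%:R :> R.
  rewrite -!natrM subnS mul_bin_down; congr (_ * _)%:R; lia.
rewrite !natrB; [|lia..]; rewrite natrM => E.
transitivity (- pochhammer (- (2 * m%:R)) n *
  ((2 * m%:R - n%:R) * 'C(2 * m - n.+1, m)%:R) : R); first by ring.
by rewrite E; ring.
Qed.

Lemma hyp2F1_krawtchouk (R : realType) (m k : nat) : (k <= 2 * m)%N ->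
  hyp2F1 (- m%:R) (- k%:R) (- (2 * m%:R)) 2 =
  krawtchouk R m k / 'C(2 * m, m)%:R.
Proof.
move=> km; rewrite /hyp2F1.
have C0 : ('C(2 * m, m)%:R : R) != 0 by rewrite pnatr_eq0 -lt0n bin_gt0; lia.
set a := fun n : nat => _.
have aE n :
    a n = 'C(k, n)%:R * (- 2) ^+ n * 'C(2 * m - n, m)%:R / 'C(2 * m, m)%:R.
  rewrite /a [pochhammer (- k%:R) n]pochhammer_oppr_bin.
  (* For [n > k] both sides are 0 whatever the denominator; for [n <= k <= 2 * m] the denominator is
     nonzero. *)
  have [nk|kn] := leqP n k; last by rewrite (bin_small kn) !(mulr0, mul0r).
  have p0 : pochhammer (- (2 * m%:R) : R) n != 0.
    by rewrite -natrM pochhammer_oppr_neq0//; lia.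
  have f0 : (n`!%:R : R) != 0 by rewrite pnatr_eq0 -lt0n fact_gt0.
  have -> : pochhammer (- m%:R) n = 'C(2 * m - n, m)%:R *
      pochhammer (- (2 * m%:R) : R) n / 'C(2 * m, m)%:R.
    by rewrite bin_ratio mulrC mulKf.
  by rewrite -[in RHS]mulN1r exprMn; field; rewrite ?f0 ?p0 ?C0.
rewrite /krawtchouk mulr_suml.
under [RHS]eq_bigr do rewrite -aE.
(* The partial sums are constant from index [k.+1] on. *)
apply: lim_near_cst => //; near=> n.
have kn : (k.+1 <= n)%N by near: n; exists k.+1.
rewrite /series /= (big_cat_nat (n := k.+1))//= big_mkord.
rewrite [X in _ + X]big_nat_cond [X in _ + X]big1 ?addr0//.
move=> i /andP[/andP[ki _] _].
by rewrite aE bin_small// !mul0r.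
Unshelve. all: by end_near.
Qed.

(** * Euler's integral at positive integers and at 1/2 *)

Section Gamma_integral_values.
Local Open Scope classical_set_scope.

(** The antiderivative of t^n exp(-t) obtained by repeated integration by parts, normalized to
    vanish at infinity. *)
Fixpoint gamma_primitive (R : realType) (n : nat) (t : R) : R :=
  if n is p.+1 then p.+1%:R * gamma_primitive R p t - t ^+ p.+1 * expR (- t)
  else - expR (- t).

Lemma is_derive_gamma_primitive (R : realType) (n : nat) (t : R) :
  is_derive t 1 (gamma_primitive R n) (t ^+ n * expR (- t)).
Proof.
have dE : is_derive t 1 (fun t => expR (- t) : R) (- expR (- t)).
  rewrite -mulrN1 -[X in is_derive _ _ X _]/(expR \o -%R).
  exact: is_derive1_comp.
elim: n => [|n IH] /=.
  by apply: is_derive_eq; rewrite opprK expr0 mul1r.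
have dX : is_derive t 1 (fun t => t ^+ n.+1 : R) (n.+1%:R * t ^+ n).
  have := is_deriveX n.+1 (is_derive_id t (1 : R)).
  by rewrite /GRing.scale/= mulr1 exprfctE.
by apply: is_derive_eq; rewrite /GRing.scale/= exprS; ring.
Qed.

Lemma cvgy_exprn_expRN (R : realType) (n : nat) :
  (t ^+ n * expR (- t) : R) @[t --> +oo] --> 0.
Proof.
apply/cvgrPdist_le => e e0; near=> t.
have t0 : 0 < t by near: t; exact: nbhs_pinfty_gt.
(* Beyond this threshold e t^(n+1) / (n+1)! is at least t^n, while exp t dominates t^(n+1) /
   (n+1)!. *)
have te : n.+1`!%:R / e <= t by near: t; apply: nbhs_pinfty_ge; exact: num_real.
rewrite sub0r normrN ger0_norm ?mulr_ge0 ?exprn_ge0 ?expR_ge0 ?(ltW t0)//.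
rewrite expRN ler_pdivrMr ?expR_gt0//.
have := expR_ge1Dxn n (ltW t0).
have f0 : 0 < n.+1`!%:R :> R by rewrite ltr0n fact_gt0.
rewrite -(ler_pM2l e0); apply: le_trans.
rewrite mulrDr; apply: ler_wpDl; first by rewrite mulr1 ltW.
have -> : e * (t ^+ n.+1 / n.+1`!%:R) = e * t / n.+1`!%:R * t ^+ n.
  by rewrite exprS; ring.
rewrite ler_peMl ?exprn_ge0 ?(ltW t0)//.
by rewrite ler_pdivlMr// mul1r mulrC -ler_pdivrMr.
Unshelve. all: by end_near. Qed.

Lemma cvgy_gamma_primitive (R : realType) (n : nat) :
  gamma_primitive R n t @[t --> +oo] --> 0.
Proof.
elim: n => [|n IH] /=; first by rewrite -oppr0; apply: cvgN; exact: cvgr_expR.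
rewrite -[X in _ --> X]subr0 -[X in _ --> X - _](mulr0 n.+1%:R).
apply: cvgB; last exact: (cvgy_exprn_expRN R n.+1).
by apply: cvgM => //; exact: cvg_cst.
Qed.

Lemma gamma_primitive0 (R : realType) (n : nat) :
  gamma_primitive R n 0 = - n`!%:R.
Proof.
elim: n => [|n IH] /=; first by rewrite oppr0 expR0.
by rewrite IH expr0n mul0r subr0 mulrN -natrM -factS.
Qed.

Lemma measurable_gamma_integrand (R : realType) (x : R) (A : set R) :
  measurable_fun A (fun t : R => t `^ x * expR (- t)).
Proof.
apply: measurable_funTS; apply: measurable_funM.
  exact: measurable_powR.
by apply: measurableT_comp => //; exact: measurable_expR.
Qed.

Lemma Gamma_integral_nat (R : realType) (n : nat) :
  Gamma_integral (n%:R + 1 : R) = n`!%:R.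
Proof.
rewrite /Gamma_integral addrK.
transitivity
    (\int[lebesgue_measure]_(t in `[0%R, +oo[) (t ^+ n * expR (- t)) : R).
  (* Adding the endpoint 0 does not change the integral and gives the closed half-line on which the
     fundamental theorem is applied. *)
  rewrite /Rintegral integral_itv_obnd_cbnd; last first.
    by apply/measurable_EFinP; exact: measurable_gamma_integrand.
  congr fine; apply: eq_integral => t; rewrite inE/= in_itv/= andbT => t0.
  by rewrite powR_mulrn.
have dF t := is_derive_gamma_primitive R n t.
rewrite (Rintegral_ge0_continuous_FTC2y _ _ (cvgy_gamma_primitive R n)).
- by rewrite gamma_primitive0 sub0r opprK.
- by move=> t t0; rewrite mulr_ge0 ?exprn_ge0 ?expR_ge0.
- apply: continuous_subspaceT => t; apply: cvgM.
    exact: exprn_continuous.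
  by apply: continuous_comp; [exact: opp_continuous|exact: continuous_expR].
- by move=> t _; exact: ex_derive.
- apply: cvg_at_right_filter; apply: differentiable_continuous.
  by apply/derivable1_diffP; exact: ex_derive.
- by move=> t _; rewrite derive1E derive_val.
Qed.

Lemma Gamma_natS (R : realType) (n : nat) : Gamma (n%:R + 1 : R) = n`!%:R.
Proof.
have n0 : 0 < n%:R + 1 :> R by rewrite ltr_wpDl.
by rewrite /Gamma /Gamma_shift n0 pochhammer0 addr0 divr1 Gamma_integral_nat.
Qed.

(** Since exp(-t) <= 1 / (1 + t), the integrand is at most the derivative of 2 atan (sqrt t), whose
    limit at infinity is pi. The bound is uniform in [a], which is kept away from the singularity at
    0. *)
Lemma integral_gamma_half_le (R : realType) (a : R) : 0 < a ->
  (\int[lebesgue_measure]_(t in `[a, +oo[)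
     (t `^ (1 / 2 - 1) * expR (- t))%:E <= pi%:E)%E.
Proof.
move=> a0; pose h t : R := (Num.sqrt t)^-1 * (1 + t)^-1.
have ch (t : R) : 0 < t -> {for t, continuous h}.
  move=> t0; apply: cvgM.
    by apply: continuousV; [rewrite gt_eqF// sqrtr_gt0|exact: sqrt_continuous].
  apply: continuousV; first by rewrite gt_eqF// addr_gt0.
  by apply: continuousD => //; exact: cst_continuous.
have h0 (t : R) : a <= t -> 0 <= h t.
  by move=> at_; rewrite mulr_ge0// invr_ge0 ?sqrtr_ge0// addr_ge0//
    (le_trans (ltW a0)).
have cha : {within `[a, +oo[, continuous h}.
  apply/continuous_within_itvcyP; split.
    by move=> t; rewrite in_itv/= andbT => at_; exact/ch/(lt_trans a0).
  by apply: cvg_at_right_filter; exact: ch.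
pose F t : R := 2 * atan (Num.sqrt t).
have dF (t : R) : 0 < t -> is_derive t 1 F (h t).
  move=> t0.
  have := is_derive1_comp (is_derive1_atan (Num.sqrt t)) (is_derive1_sqrt t0).
  move=> D; rewrite /F; apply: is_derive_eq.
  rewrite sqr_sqrtr ?(ltW t0)// /h -mulr_algl.
  have s0 : Num.sqrt t != 0 by rewrite gt_eqF// sqrtr_gt0.
  have t1 : 1 + t != 0 by rewrite gt_eqF// addr_gt0.
  by rewrite mulr_algl /GRing.scale/=; field; rewrite s0 t1.
have Fy : F t @[t --> +oo] --> 2 * (pi / 2).
  apply: cvgM; first exact: cvg_cst.
  apply: (cvg_comp (fun t : R => Num.sqrt t) (@atan R)); last exact: cvgy_atan.
  apply/cvgryPge => A; near=> t.
  have At : A ^+ 2 <= t by near: t; apply: nbhs_pinfty_ge; exact: num_real.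
  by rewrite (le_trans (ler_norm A))// -sqrtr_sqr ler_wsqrtr.
apply: (@le_trans _ _ (\int[lebesgue_measure]_(t in `[a, +oo[) (h t)%:E)%E).
  apply: ge0_le_integral => //.
  - by move=> t _; rewrite lee_fin mulr_ge0 ?powR_ge0 ?expR_ge0.
  - by apply/measurable_EFinP; exact: measurable_gamma_integrand.
  - by apply/measurable_EFinP; exact: subspace_continuous_measurable_fun.
  move=> t; rewrite /= in_itv/= andbT lee_fin => at_.
  have t0 := lt_le_trans a0 at_.
  rewrite (_ : 1 / 2 - 1 = - 2^-1); last by field.
  rewrite powRN powR12_sqrt ?(ltW t0)// ler_wpM2l ?invr_ge0 ?sqrtr_ge0//.
  by rewrite expRN lef_pV2 ?posrE ?expR_gt0 ?addr_gt0// expR_ge1Dx.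
rewrite (ge0_continuous_FTC2y h0 cha Fy).
- rewrite -EFinB lee_fin mulrCA divff// mulr1 gerBl mulr_ge0//.
  by rewrite -atan0 le_atan// sqrtr_ge0.
- by move=> t at_; have := dF _ (lt_trans a0 at_) => ?; exact: ex_derive.
- have := dF _ a0 => ?; apply: cvg_at_right_filter.
  apply: differentiable_continuous; apply/derivable1_diffP; exact: ex_derive.
- move=> t; rewrite in_itv/= andbT => at_; have := dF _ (lt_trans a0 at_) => ?.
  by rewrite derive1E derive_val.
Unshelve. all: by end_near. Qed.

(** [fine] sends +oo to 0, so the extended integral must be shown both positive and finite. *)
Lemma Gamma_integral_half_gt0 (R : realType) :
  0 < Gamma_integral (1 / 2 : R).
Proof.
rewrite /Gamma_integral; apply: fine_gt0; apply/andP; split.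
  (* On [1, 2], exp(-t) >= exp(-2), and 1 / sqrt t >= 1/2 because sqrt t <= 2. *)
  pose c : R := expR (- 2) / 2.
  apply: (@lt_le_trans _ _
      (\int[lebesgue_measure]_(t in `[1%R, 2%R]) (cst c%:E t))%E).
    rewrite integral_cst//= lebesgue_measure_itv/= lte_fin ltr1n.
    rewrite -EFinB -EFinM lte_fin.
    by rewrite mulr_gt0 ?divr_gt0 ?expR_gt0// subr_gt0 ltr1n.
  apply: (@le_trans _ _ (\int[lebesgue_measure]_(t in `[1%R, 2%R])
      (t `^ (1 / 2 - 1) * expR (- t))%:E)%E).
    apply: ge0_le_integral => //.
    - by move=> t _; rewrite lee_fin divr_ge0 ?expR_ge0.
    - by apply/measurable_EFinP; exact: measurable_gamma_integrand.
    move=> t; rewrite /= in_itv/= lee_fin => /andP[t1 t2].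
    have t0 : 0 < t by rewrite (lt_le_trans _ t1).
    rewrite (_ : 1 / 2 - 1 = - 2^-1); last by field.
    rewrite powRN powR12_sqrt ?(ltW t0)// /c mulrC ler_pM ?invr_ge0 ?expR_ge0//.
      rewrite lef_pV2 ?posrE ?sqrtr_gt0// (le_trans (ler_wsqrtr t2))//.
      by rewrite -[leRHS](@ger0_norm R 2)// -sqrtr_sqr ler_wsqrtr// expr2; lra.
    by rewrite ler_expR lerN2.
  apply: ge0_subset_integral => //.
  - by apply/measurable_EFinP; exact: measurable_gamma_integrand.
  - by move=> t _; rewrite lee_fin mulr_ge0 ?powR_ge0 ?expR_ge0.
  - move=> t /=; rewrite !in_itv/= andbT => /andP[t1 _].
    by rewrite (lt_le_trans _ t1).
apply: (@le_lt_trans _ _ pi%:E); last exact: ltry.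
(* These half-lines increase to ]0, +oo[, so monotone convergence carries the uniform bound pi to
   the whole integral. *)
pose A n : set R := `[n.+1%:R^-1, +oo[.
have -> : `]0%R, +oo[ = \bigcup_n A n.
  apply/seteqP; split => t /=.
    rewrite in_itv/= andbT => t0; exists (Num.truncn t^-1) => //=.
    rewrite /A/= in_itv/= andbT -[leRHS]invrK lef_pV2 ?posrE ?invr_gt0//.
    exact/ltW/truncnS_gt.
  rewrite /A => -[n _] /=; rewrite !in_itv/= !andbT.
  by apply: lt_le_trans; rewrite invr_gt0.
have cv : (\int[lebesgue_measure]_(t in A n)
      (t `^ (1 / 2 - 1) * expR (- t))%:E @[n --> \oo] -->
    \int[lebesgue_measure]_(t in \bigcup_n A n)
      (t `^ (1 / 2 - 1) * expR (- t))%:E)%E.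
  apply: ge0_nondecreasing_set_cvg_integral => //.
  - move=> n p np; apply/subsetPset => t; rewrite /A/= !in_itv/= !andbT.
    by apply: le_trans; rewrite lef_pV2 ?posrE// ler_nat.
  - by move=> n; exact: measurable_itv.
  - by move=> n; apply/measurable_EFinP; exact: measurable_gamma_integrand.
  - by move=> n t _; rewrite lee_fin mulr_ge0 ?powR_ge0 ?expR_ge0.
rewrite -(cvg_lim _ cv)//; apply: lime_le.
  by apply/cvg_ex; eexists; exact: cv.
by near=> n; apply: integral_gamma_half_le; rewrite invr_gt0.
Unshelve. all: by end_near. Qed.

End Gamma_integral_values.

(** * Gamma at half-integers and the closed form *)

(** The least shift making 1/2 - p positive is p, and it lands on 1/2. *)
Lemma Gamma_half_sub (R : realType) (p : nat) :
  Gamma (1 / 2 - p%:R : R) =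
  Gamma_integral (1 / 2) / pochhammer (1 / 2 - p%:R) p.
Proof.
rewrite /Gamma; suff -> : Gamma_shift (1 / 2 - p%:R : R) = p by rewrite subrK.
rewrite /Gamma_shift; case: p => [|p].
  by rewrite subr0 divr_gt0.
have p1 : 0 <= p%:R :> R by [].
rewrite -[p.+1%:R]natr1 ifF; last by apply/negbTE; rewrite -leNgt; lra.
by congr S; apply: truncn_def; rewrite -[p.+1%:R]natr1; lra.
Qed.

Lemma pochhammerD (R : realType) (a : R) (n p : nat) :
  pochhammer a (n + p) = pochhammer a n * pochhammer (a + n%:R) p.
Proof.
elim: p => [|p IH]; first by rewrite addn0 pochhammer0 mulr1.
by rewrite addnS !pochhammerS IH natrD -mulrA addrA.
Qed.

Lemma pochhammer_half_neq0 (R : realType) (p n : nat) :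
  pochhammer (1 / 2 - p%:R : R) n != 0.
Proof.
apply/prodf_neq0 => j _; apply/eqP => E.
have : (1 + 2 * j%:R) = 2 * p%:R :> R by lra.
by rewrite -!natrM => /eqP; rewrite addrC natr1 eqr_nat => /eqP; lia.
Qed.

Lemma pochhammer_half (R : realType) (l : nat) :
  pochhammer (1 / 2 : R) l = (l.*2)`!%:R / (4 ^+ l * l`!%:R).
Proof.
elim: l => [|l IH]; first by rewrite pochhammer0 !fact0 expr0 mulr1 divr1.
have f0 : (l`!%:R : R) != 0 by rewrite pnatr_eq0 -lt0n fact_gt0.
have l0 : 0 <= l%:R :> R by [].
rewrite pochhammerS IH doubleS !factS !natrM -!natr1 -muln2 natrM exprS.
field; rewrite ?f0 ?expf_neq0//=; lra.
Qed.

(** Both values are multiples of the nonzero integral at 1/2, which cancels; what remains is the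
    splitting of (1/2 - m)_m after its first l factors. *)
Lemma Gamma_half_ratio (R : realType) (m l : nat) : (l <= m)%N ->
  Gamma (1 / 2 - m%:R : R) * rGamma (1 / 2 - (m - l)%:R) =
  (pochhammer (1 / 2 - m%:R) l)^-1.
Proof.
move=> lm; rewrite /rGamma.
(* The argument is not a pole, so [rGamma] is the actual inverse. *)
have -> : (1 / 2 - (m - l)%:R : R) \is a Num.int = false.
  apply/negP => /intrP[z E].
  have E2 : 2 * (z%:~R + (m - l)%:R) = 1 :> R by rewrite -E; field.
  have : 2 * (z + (m - l)%:Z) = 1; last by lia.
  by apply: (@intr_inj R); rewrite intrM intrD; exact: E2.
rewrite !Gamma_half_sub -{2}(subnKC lm) pochhammerD.
have -> : 1 / 2 - m%:R + l%:R = 1 / 2 - (m - l)%:R :> R.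
  by rewrite natrB//; ring.
have := gt_eqF (Gamma_integral_half_gt0 R) => /negbT G0.
have := pochhammer_half_neq0 R (m - l) (m - l) => p0.
have := pochhammer_half_neq0 R m l => q0.
by rewrite /=; field; rewrite p0 q0 G0.
Qed.

(** For odd [k] both sides are 0. For k = 2l, the closed form of c_(2l) meets (1/2)_l = (2l)! / (4^l
    l!), and the last argument becomes 1/2 - (m - l). *)
Lemma krawtchouk_Gamma (R : realType) (m k : nat) : (0 < k <= 2 * m)%N ->
  krawtchouk R m k / 'C(2 * m, m)%:R =
  (1 + (-1) ^+ k) / 2 *
    (Gamma (k%:R + 1) * Gamma (1 / 2 - m%:R) / (2 ^+ k * Gamma (k%:R / 2 + 1))
     * rGamma ((k%:R + 1) / 2 - m%:R)).
Proof.
move=> /andP[k0 km]; rewrite -signr_odd; case: (boolP (odd k)) => ok.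
  by rewrite krawtchouk_odd// expr1 subrr !mul0r.
have [l kl] : exists l, k = l.*2 by exists k./2; lia.
have C0 : ('C(2 * m, m)%:R : R) != 0 by rewrite pnatr_eq0 -lt0n bin_gt0; lia.
have lm : (l <= m)%N by lia.
have -> : (k%:R / 2 : R) = l%:R by rewrite kl -muln2 natrM mulfK.
have -> : ((k%:R + 1) / 2 - m%:R : R) = 1 / 2 - (m - l)%:R.
  by rewrite kl natrB// -muln2 natrM; field.
rewrite !Gamma_natS.
have q0 := pochhammer_half_neq0 R m l.
have -> : krawtchouk R m k = 'C(2 * m, m)%:R *
    pochhammer (1 / 2 : R) l / pochhammer (1 / 2 - m%:R) l.
  by rewrite -krawtchouk_even// -kl mulfK.
have -> : (2 : R) ^+ k = 4 ^+ l.
  by rewrite kl -mul2n exprM; congr (_ ^+ _); ring.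
rewrite pochhammer_half expr0 -kl.
have f0 : (l`!%:R : R) != 0 by rewrite pnatr_eq0 -lt0n fact_gt0.
transitivity (k`!%:R / (4 ^+ l * l`!%:R) *
    (pochhammer (1 / 2 - m%:R) l)^-1 : R).
  by field; rewrite ?q0 ?C0 ?f0 ?expf_neq0.
by rewrite -(Gamma_half_ratio _ _ _ lm); field; rewrite f0 expf_neq0.
Qed.

Theorem theorem5p7 (R : realType) (d : nat) (r : int)
    (hd : (2 <= d)%N)
    (hr : r%:~R <= (d%:R / 2 : R) <= r%:~R + 1) :
  exch_sym_bernoulli_pmf (@END_pmf R d r) /\
  (exists theta : nat -> R,
     dependence_parameters (FGM_copula (@END_pmf R d r)) theta) /\
  (forall theta : nat -> R,
     dependence_parameters (FGM_copula (@END_pmf R d r)) theta ->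
     forall k : nat, (2 <= k <= d)%N ->
       let m := ((d + 1) %/ 2)%N in
       theta k = hyp2F1 (- m%:R) (- k%:R) (- (2 * m%:R)) 2 /\
       hyp2F1 (- m%:R) (- k%:R) (- (2 * m%:R)) 2 =
         (1 + (-1) ^+ k) / 2 *
         (Gamma (k%:R + 1) * Gamma (1 / 2 - m%:R)
            / (2 ^+ k * Gamma (k%:R / 2 + 1))
            * rGamma ((k%:R + 1) / 2 - m%:R) : R)).
Proof.
have END_theta := END_dependence_parameters R d r hd hr.
split; first exact: END_pmf_exch.
split; first by eexists; exact: END_theta.
move=> theta htheta k hk m; rewrite hyp2F1_krawtchouk; last by lia.
split; first exact: (dependence_parameters_unique _ _ _ _ _ htheta END_theta).
by apply: krawtchouk_Gamma; lia.
Qed.
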